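(* Let $p\in\{2,3\}$. Let $E/\mathbb{Q}$ be an elliptic curve and denote its conductor by $N_E$. Suppose that $E$ admits a $p$-torsion point defined over $\mathbb{Q}$ (i.e. $E(\mathbb{Q})$ contains a point of exact order $p$). Then $$a_\ell(E)\equiv \tau(\ell)\pmod p$$ for all primes $\ell\nmid pN_E$.
   Context: Ramanujan's tau function $\tau:\{1,2,3,\dots\}\to\mathbb{Z}$ is defined by the identity of formal power series $\sum_{n\ge 1}\tau(n)q^n=q\prod_{n\ge 1}(1-q^n)^{24}$. For a prime $\ell$ of good reduction of $E$, $a_\ell(E)=1+\ell-|E(\mathbb{F}_\ell)|$. *)

(* Defs.v *)
From mathcomp Require Import all_boot all_order all_algebra all_fingroup all_field.
From mathcomp Require Import boolp.
From Stdlib Require Import ClassicalEpsilon.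

Set Implicit Arguments.
Unset Strict Implicit.
Unset Printing Implicit Defensive.

Import Order.TTheory GRing.Theory Num.Theory.

Local Open Scope ring_scope.

(* y^2 + a1 x y + a3 y = x^3 + a2 x^2 + a4 x + a6 *)
Record weierstrass (R : Type) :=
  Weierstrass { a1 : R; a2 : R; a3 : R; a4 : R; a6 : R }.

Definition map_weierstrass (R S : Type) (f : R -> S) (W : weierstrass R) :=
  Weierstrass (f (a1 W)) (f (a2 W)) (f (a3 W)) (f (a4 W)) (f (a6 W)).

Section Invariants.
Variables (R : comPzRingType) (W : weierstrass R).

Definition b2 : R := a1 W ^+ 2 + 4 * a2 W.
Definition b4 : R := 2 * a4 W + a1 W * a3 W.
Definition b6 : R := a3 W ^+ 2 + 4 * a6 W.
Definition b8 : R :=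
  a1 W ^+ 2 * a6 W + 4 * a2 W * a6 W - a1 W * a3 W * a4 W
  + a2 W * a3 W ^+ 2 - a4 W ^+ 2.
Definition disc : R :=
  - (b2 ^+ 2 * b8) - 8 * b4 ^+ 3 - 27 * b6 ^+ 2 + 9 * b2 * b4 * b6.

Definition on_affine (x y : R) : bool :=
  y ^+ 2 + a1 W * x * y + a3 W * y == x ^+ 3 + a2 W * x ^+ 2 + a4 W * x + a6 W.

Definition singular_at (x y : R) : Prop :=
  [/\ on_affine x y,
      a1 W * y = 3 * x ^+ 2 + 2 * a2 W * x + a4 W
    & 2 * y + a1 W * x + a3 W = 0].

(* At a singular point (x, y) the tangent cone is Y^2 + a1 X Y - (3 x + a2) X^2,
   whose discriminant is b2 + 12 x; it splits into two distinct lines over an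
   algebraic closure exactly when this is nonzero, in every characteristic.
   Over a finite field the singular point, if any, is rational. *)
Definition has_node : Prop :=
  exists x y, singular_at x y /\ b2 + 12 * x <> 0.

End Invariants.

Record elliptic_curve (F : fieldType) := EllipticCurve {
  ec_model :> weierstrass F;
  ec_disc_neq0 : disc ec_model != 0 }.

(* [None] is the point at infinity. *)
Notation point F := (option (F * F)).

Section Points.
Variables (F : fieldType) (W : weierstrass F).

Definition on_curve (P : point F) : bool :=
  if P is Some (x, y) then on_affine W x y else true.

Definition add_point (P Q : point F) : point F :=
  match P, Q with
  | None, _ => Q
  | _, None => P
  | Some (x1, y1), Some (x2, y2) =>
      if (x1 == x2) && (y1 + y2 + a1 W * x2 + a3 W == 0) then None else
      let m := if x1 == x2
        then (3 * x1 ^+ 2 + 2 * a2 W * x1 + a4 W - a1 W * y1)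
               / (2 * y1 + a1 W * x1 + a3 W)
        else (y2 - y1) / (x2 - x1) in
      let x3 := m ^+ 2 + a1 W * m - a2 W - x1 - x2 in
      Some (x3, - (m * (x3 - x1) + y1) - a1 W * x3 - a3 W)
  end.

Definition mul_point (n : nat) (P : point F) : point F :=
  iter n (add_point P) None.

Definition has_exact_order (P : point F) (n : nat) : Prop :=
  [/\ (0 < n)%N, mul_point n P = None
    & forall m : nat, (0 < m < n)%N -> mul_point m P <> None].

(* W' is obtained from W by x = u^2 x' + r, y = u^3 y' + u^2 s x' + t. *)
Definition change_of_variables (u r s t : F) (W' : weierstrass F) : Prop :=
  [/\ u * a1 W' = a1 W + 2 * s,
      u ^+ 2 * a2 W' = a2 W - s * a1 W + 3 * r - s ^+ 2,
      u ^+ 3 * a3 W' = a3 W + r * a1 W + 2 * t,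
      u ^+ 4 * a4 W' = a4 W - s * a3 W + 2 * r * a2 W
                       - (t + r * s) * a1 W + 3 * r ^+ 2 - 2 * s * t
    & u ^+ 6 * a6 W' = a6 W + r * a4 W + r ^+ 2 * a2 W + r ^+ 3
                       - t * a3 W - t ^+ 2 - r * t * a1 W].

End Points.

Section Reduction.
Variable E : elliptic_curve rat.

Definition is_integral_model (W : weierstrass int) : Prop :=
  exists u r s t : rat, u != 0 /\
    change_of_variables E u r s t (map_weierstrass (fun z : int => z%:~R) W).

Let W0 : weierstrass int := Weierstrass 0 0 0 0 0.

Definition integral_model : weierstrass int :=
  epsilon (inhabits W0) is_integral_model.

(* Minimality at l among models over Z is the same as among models over the
   localization of Z at l: scaling by an integer u prime to l clears the other
   denominators without changing the l-adic valuation of the discriminant. *)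
Definition is_minimal_model (l : nat) (W : weierstrass int) : Prop :=
  is_integral_model W /\
  forall W', is_integral_model W' ->
    (logn l `|disc W| <= logn l `|disc W'|)%N.

Definition minimal_model (l : nat) : weierstrass int :=
  epsilon (inhabits W0) (is_minimal_model l).

(* Meaningful only for l prime: 'F_l is otherwise F_q for q the least prime
   factor of l. *)
Definition reduction (l : nat) : weierstrass 'F_l :=
  map_weierstrass (fun z : int => z%:~R) (minimal_model l).

Definition good_reduction (l : nat) : bool := disc (reduction l) != 0.

Definition multiplicative_reduction (l : nat) : Prop :=
  has_node (reduction l).

Definition card_reduction (l : nat) : nat :=
  #|[set P : point 'F_l | on_curve (reduction l) P]|.

Definition trace_frob (l : nat) : int := 1 + l%:Z - (card_reduction l)%:Z.

End Reduction.

Section Ramification.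
Variable L : splittingFieldType rat.

Definition is_integral (x : L) : Prop :=
  exists m : {poly int},
    m \is monic /\ root (map_poly (fun z : int => z%:~R) m) x.

Record is_prime_above (q : nat) (I : L -> Prop) : Prop := IsPrimeAbove {
  prime_above_int : forall x, I x -> is_integral x;
  prime_above_sub : forall x y, I x -> I y -> I (x - y);
  prime_above_mul : forall a x, is_integral a -> I x -> I (a * x);
  prime_above_proper : ~ I 1;
  prime_above_prime :
    forall a b, is_integral a -> is_integral b -> I (a * b) -> I a \/ I b;
  prime_above_q : I q%:R }.

(* For n > 0: x is a finite sum of products of n elements of I. *)
Definition ideal_power (I : L -> Prop) (n : nat) (x : L) : Prop :=
  exists ts : seq (n.-tuple L),
    (forall t, t \in ts -> forall y, y \in (t : seq L) -> I y)
    /\ x = \sum_(t <- ts) \prod_(y <- t) y.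

(* The i-th ramification group, in lower numbering, of the completion of L at
   I over Q_q: for i >= 0 the condition below forces s to fix I, and the ring
   of integers of L is dense in the ring of integers of the completion. *)
Definition ramification_group (I : L -> Prop) (i : nat) : {set gal_of {:L}} :=
  [set s in ('Gal({:L} / 1))%g |
    `[< forall x : L, is_integral x -> ideal_power I i.+1 (s x - x) >]].

Definition gal_point (s : gal_of {:L}) (P : point L) : point L :=
  omap (fun xy => (s xy.1, s xy.2)) P.

Definition coordinates (T : seq (point L)) : seq L :=
  flatten [seq (if P is Some (x, y) then [:: x; y] else [::]) | P <- T].

(* T enumerates E[l], all of whose points are defined over L = Q(E[l]). *)
Definition is_torsion_field (E : elliptic_curve rat) (l : nat)
    (T : seq (point L)) : Prop :=
  let EL := map_weierstrass (fun a : rat => a%:A : L) E in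
  [/\ uniq T,
      forall P, (P \in T) = on_curve EL P && (mul_point EL l P == None),
      size T = (l ^ 2)%N
    & <<1 & coordinates T>>%VS = fullv].

(* dim_{F_l} (E[l] / E[l]^G) *)
Definition torsion_codim (l : nat) (T : seq (point L))
    (G : {set gal_of {:L}}) : nat :=
  (logn l (size T)
   - logn l (count (fun P => [forall s in G, gal_point s P == P]) T))%N.

End Ramification.

Section Conductor.
Variable E : elliptic_curve rat.

(* d = \sum_(i >= 1) (|G_i| / |G_0|) dim_{F_l} (E[l] / E[l]^G_i), where the G_i
   are the ramification groups of Q(E[l]) at a prime I above q and l is a prime
   other than q; the value is independent of the choices of l and I. *)
Definition is_wild_exponent (q d : nat) : Prop :=
  exists (l : nat) (L : splittingFieldType rat) (T : seq (point L))
         (I : L -> Prop) (M : nat),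
    [/\ prime l, l != q, is_torsion_field E l T & is_prime_above q I] /\
    (forall i : nat, (M <= i)%N -> #|ramification_group I i| = 1%N) /\
    d%:R = \sum_(1 <= i < M)
             #|ramification_group I i|%:R / #|ramification_group I 0|%:R
             * (torsion_codim l T (ramification_group I i))%:R :> rat.

Definition wild_exponent (q : nat) : nat :=
  epsilon (inhabits 0%N) (is_wild_exponent q).

Definition conductor_exponent (q : nat) : nat :=
  if good_reduction E q then 0%N
  else if `[< multiplicative_reduction E q >] then 1%N
  else (2 + wild_exponent q)%N.

(* Every prime of bad reduction divides the discriminant of any integral
   model, so the product runs over all primes with a nonzero exponent. *)
Definition conductor : nat :=
  (\prod_(q <- primes `|disc (integral_model E)|) q ^ conductor_exponent q)%N.

End Conductor.

(* The factors 1 - X^k with k > n do not affect the coefficient of X^n in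
   X * \prod_(k >= 1) (1 - X^k)^24. *)
Definition tau (n : nat) : int :=
  ('X * \prod_(1 <= k < n.+1) (1 - 'X^k) ^+ 24 : {poly int})`_n.

(* Main.v *)
Require Import Defs.
From mathcomp Require Import all_boot all_order all_algebra all_fingroup all_field.
From mathcomp Require Import cyclic pgroup sylow boolp.
From Stdlib Require Import ClassicalEpsilon.
From mathcomp Require Import zify ring.

Set Implicit Arguments.
Unset Strict Implicit.
Unset Printing Implicit Defensive.
Import Order.TTheory GRing.Theory Num.Theory.
Local Open Scope ring_scope.

(** Both sides are congruent to 1 + l modulo p.

On the side of E, a prime l not dividing p N_E is a prime of good reduction
([conductor_good_reduction]), and p divides the number of points of the
reduction ([dvd_card_reduction]).  To see the latter without the general group
law, encode a rational point of order p by the change of variables which moves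
it to the origin with horizontal tangent: the model becomes
y^2 + a1 x y = x^3 + a2 x^2 + a4 x for p = 2 and y^2 + a1 x y + a3 y = x^3 for
p = 3.  The parameters of this change of variables are rational roots of
polynomials whose leading coefficients are, up to powers of p, equal to 1, so
they have no l in their denominators and make sense modulo l.  On the reduced
normal form, translation by the origin is given by a short formula; it has
order p and, the discriminant being nonzero, no fixed point, so that it cuts
the set of points into orbits of size p.

On the side of tau, let D = X d/dX and S = \sum sigma(n) X^n.  Niebur's formula
  tau(n) = n^4 sigma(n) - 24 [X^n] (S D^4 S - 16 DS D^3 S + 18 (D^2 S)^2)
gives tau(l) = l^4 (1 + l) modulo 24, hence 1 + l modulo p
([tau_prime_mod24]).  The formula holds because both generating series solve
the linear equation D T = (1 - 24 S) T, whose solutions are determined by their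
coefficient of X: for X \prod (1 - X^k)^24 this is logarithmic
differentiation, and for the right-hand side it is a formal consequence of
Chazy's equation
  D^3 S - D^2 S + 24 S D^2 S - 36 (DS)^2 = 0.
Taken coefficient by coefficient, Chazy's equation is an identity for sums over
the solutions of a x + b y = n in positive integers ([van_der_Pol]), and it is
proved by the bijection (a, b, x, y) |-> (a, a + b, x - y, y) from the solutions
with x > y onto those with a < b.

Power series are represented by polynomials, compared up to degree M. *)

(** * Positive solutions of a x + b y = n *)

Section Quadruples.
Variables (M n : nat).
Hypothesis le_nM : (n <= M)%N.
Local Notation I := 'I_M.+1.
Local Notation quad := ((I * I) * (I * I))%type.

Definition factorizations (p : I * I) : bool :=
  [&& (0 < p.1)%N, (0 < p.2)%N & (p.1 * p.2 == n)%N].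

(** A quadruple is stored as ((a, x), (b, y)), so that each half is a
factorization of one of the two summands. *)
Definition quadruples (q : quad) : bool :=
  [&& (0 < q.1.1)%N, (0 < q.1.2)%N, (0 < q.2.1)%N, (0 < q.2.2)%N
    & (q.1.1 * q.1.2 + q.2.1 * q.2.2 == n)%N].

(** The identity a x + b y = a (x - y) + (a + b) y makes
(a, b, x, y) |-> (a, a + b, x - y, y) a bijection from the solutions with y < x
onto the solutions with a < b. *)
Lemma sum_quadruples_shear (F : nat -> nat -> nat -> nat -> int) :
  \sum_(q : quad | quadruples q && (q.2.2 < q.1.2)%N) F q.1.1 q.2.1 q.1.2 q.2.2
  = \sum_(q : quad | quadruples q && (q.1.1 < q.2.1)%N)
      F q.1.1 (q.2.1 - q.1.1)%N (q.1.2 + q.2.2)%N q.2.2.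
Proof.
pose h (q : quad) : quad :=
  ((q.1.1, inord (q.1.2 + q.2.2)), (inord (q.2.1 - q.1.1), q.2.2)).
pose h' (q : quad) : quad :=
  ((q.1.1, inord (q.1.2 - q.2.2)), (inord (q.1.1 + q.2.1), q.2.2)).
have ltM (i : I) : (i < M.+1)%N by exact: ltn_ord.
rewrite (reindex_onto h h'); last first.
  move=> [[a x] [b y]] /andP[/and5P[/= a0 x0 b0 y0 /eqP e] lt_yx].
  have e1 : (inord (x - y) : I) = (x - y)%N :> nat.
    by rewrite inordK //; have := ltM x; lia.
  have e2 : (inord (a + b) : I) = (a + b)%N :> nat by rewrite inordK //; nia.
  rewrite /h /h' /=; congr ((_, _), (_, _)); apply: val_inj => /=.
    by rewrite e1 subnK ?inordK // ltnW.
  by rewrite e2 addKn inordK.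
apply: eq_big => [[[a x] [b y]]|[[a x] [b y]]]; rewrite /h /h' /=; last first.
  case/andP=> /andP[/and5P[/= a0 x0 b0 y0 /eqP e] lt_yx] _.
  (* beyond the bound, inord is 0, which is not positive *)
  have [le_xy|lt_xy] := leqP (x + y) M; last first.
    by rewrite /inord /insubd insubN // -ltnNge in x0.
  by rewrite !inordK //; have := ltM b; lia.
have e2 : (inord (b - a) : I) = (b - a)%N :> nat.
  by rewrite inordK //; have := ltM b; lia.
apply/idP/idP.
  case/andP=> /andP[/and5P[/= a0 x0 b0 y0 /eqP e] lt_yx] /eqP[ex _].
  have [le_xy|lt_xy] := leqP (x + y) M; last first.
    by rewrite /inord /insubd insubN // -ltnNge in x0.
  have e1 : (inord (x + y) : I) = (x + y)%N :> nat by rewrite inordK.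
  rewrite e1 e2 in x0 b0 e lt_yx; rewrite /quadruples /=.
  by apply/andP; split; [apply/and5P; split => //; last apply/eqP|]; nia.
case/andP=> /and5P[/= a0 x0 b0 y0 /eqP e] lt_ab.
have e1 : (inord (x + y) : I) = (x + y)%N :> nat by rewrite inordK //; nia.
rewrite /quadruples /= e1 e2; apply/andP; split.
  by apply/andP; split; [apply/and5P; split => //; last apply/eqP|]; nia.
apply/eqP; congr ((_, _), (_, _)); apply: val_inj => /=.
  by rewrite addnK inordK.
by rewrite subnKC ?inordK // ltnW.
Qed.


Lemma sum_quadruples_swap (Q : pred quad) (F : quad -> int) :
  \sum_(q : quad | quadruples q && Q q) F q
  = \sum_(q : quad | quadruples q && Q (q.2, q.1)) F (q.2, q.1).
Proof.
rewrite (reindex_inj (h := fun q : quad => (q.2, q.1))); last first.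
  by move=> [p q] [p' q'] [-> ->].
apply: eq_bigl => -[[a x] [b y]]; rewrite /quadruples /= addnC.
by congr (_ && _); apply/and5P/and5P; case.
Qed.

Lemma sum_quadruples_dual (Q : pred quad) (F : quad -> int) :
  \sum_(q : quad | quadruples q && Q q) F q
  = \sum_(q : quad | quadruples q
                     && Q ((q.1.2, q.1.1), (q.2.2, q.2.1)))
      F ((q.1.2, q.1.1), (q.2.2, q.2.1)).
Proof.
rewrite (reindex_inj (h := fun q : quad => ((q.1.2, q.1.1), (q.2.2, q.2.1))));
  last by move=> [[a x] [b y]] [[a' x'] [b' y']] [-> -> -> ->].
apply: eq_bigl => -[[a x] [b y]]; rewrite /quadruples /= mulnC [(b * y)%N]mulnC.
by congr (_ && _); apply/and5P/and5P; case.
Qed.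

Lemma sum_quadruples_trichotomy (k : I * I -> nat) (F : quad -> int) :
  (forall p q, F (p, q) = F (q, p)) ->
  \sum_(q : quad | quadruples q) F q
  = 2 * (\sum_(q : quad | quadruples q && (k q.1 < k q.2)%N) F q)
    + \sum_(q : quad | quadruples q && (k q.1 == k q.2)) F q.
Proof.
move=> symF; rewrite (bigID (fun q : quad => (k q.1 < k q.2)%N)) /=.
rewrite mulr2n mulrDl mul1r -addrA; congr (_ + _).
rewrite (bigID (fun q : quad => k q.1 == k q.2)) /= addrC; congr (_ + _); last first.
  by apply: eq_bigl => q; rewrite -andbA; congr (_ && _); lia.
rewrite [RHS]sum_quadruples_swap; apply: eq_big => [q|[p q] _]; last exact: symF.
by rewrite -andbA /=; congr (_ && _); lia.
Qed.

(** When x = y the equation reads (a + b) x = n: such solutions are the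
factorizations d x = n together with a decomposition d = a + b. *)
Lemma sum_quadruples_diag (F : nat -> nat -> nat -> int) :
  \sum_(q : quad | quadruples q && (q.1.2 == q.2.2)) F q.1.1 q.2.1 q.1.2
  = \sum_(p : I * I | factorizations p)
      \sum_(1 <= a < p.1) F a (p.1 - a)%N p.2.
Proof.
have ltM (i : I) : (i < M.+1)%N by exact: ltn_ord.
pose h (t : (I * I) * I) : quad :=
  ((t.2, t.1.2), (inord (t.1.1 - t.2), t.1.2)).
pose h' (q : quad) : (I * I) * I := ((inord (q.1.1 + q.2.1), q.1.2), q.1.1).
transitivity (\sum_(p : I * I | factorizations p)
    \sum_(a < M.+1 | (0 < a < p.1)%N) F a (p.1 - a)%N p.2).
  rewrite pair_big_dep /= (reindex_onto h h'); last first.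
    move=> [[a x] [b y]] /andP[/and5P[/= a0 x0 b0 y0 /eqP e] /eqP exy].
    have e2 : (inord (a + b) : I) = (a + b)%N :> nat by rewrite inordK //; nia.
    rewrite /h /h' /= -exy; congr (_, (_, _)); apply: val_inj => /=.
    by rewrite e2 addKn inordK.
  apply: eq_big => [[[d x] a]|[[d x] a]]; last first.
    by move=> _; rewrite /h /= inordK //; have := ltM d; lia.
  have e1 : (inord (d - a) : I) = (d - a)%N :> nat.
    by rewrite inordK //; have := ltM d; lia.
  rewrite /quadruples /factorizations /h /h' /= e1 eqxx andbT -mulnDl.
  apply/idP/idP.
    case/andP=> /and5P[a0 x0 b0 _ e] _.
    have lt_ad : (a < d)%N by rewrite -subn_gt0.
    by move: e; rewrite subnKC ?(ltnW lt_ad) // => ->; rewrite x0 a0 lt_ad; lia.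
  case/andP=> /and3P[d0 x0 e] /andP[a0 lt_ad].
  rewrite subnKC ?(ltnW lt_ad) // a0 x0 e subn_gt0 lt_ad /=.
  by apply/eqP; congr ((_, _), _); apply: val_inj; rewrite /= inordK.
apply: eq_bigr => p _; rewrite [RHS](big_nat_widen _ _ M.+1); last exact/ltnW.
rewrite [RHS](big_nat_widenl _ 0) //= big_mkord; apply: eq_bigl => a.
by rewrite andbC.
Qed.


(** Van der Pol's identity.  Among the polynomials of degree 4 in a, b and 2 in
x, y, the H below is characterized, given that
H(a, b, x, y) - H(a, b - a, x + y, y) is the summand on the left, by being
invariant under the exchange of (a, x) and (b, y) together with its sheared
form K.  Each of the two full sums is then twice a half sum plus a diagonal
sum, the half sums agree by the shear, and only the two diagonal sums remain;
these are elementary sums over the factorizations of n. *)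
Lemma van_der_Pol :
  \sum_(q : quad | quadruples q)
     (12 * q.1.1%:Z * q.2.1%:Z * (3 * (q.1.1%:Z * q.1.2%:Z) * (q.2.1%:Z * q.2.2%:Z)
       - (q.1.1%:Z * q.1.2%:Z) ^+ 2 - (q.2.1%:Z * q.2.2%:Z) ^+ 2))
  = \sum_(p : I * I | factorizations p) p.1%:Z * (n%:Z ^+ 3 - n%:Z ^+ 2).
Proof.
pose H (a b x y : int) : int :=
  - (a ^+ 4 * x ^+ 2) - b ^+ 4 * y ^+ 2
  - 6 * (a ^+ 3 * b * x ^+ 2) - 6 * (a * b ^+ 3 * y ^+ 2)
  - 6 * (a ^+ 2 * b ^+ 2 * (x ^+ 2 + y ^+ 2))
  + 8 * (a * b * (a ^+ 2 + b ^+ 2) * (x * y)) + 18 * (a ^+ 2 * b ^+ 2 * (x * y)).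
pose K (a b x y : int) : int := H a (b - a) (x + y) y.
pose ev (G : int -> int -> int -> int -> int) (q : quad) : int :=
  G q.1.1%:Z q.2.1%:Z q.1.2%:Z q.2.2%:Z.
have symH p q : ev H (p, q) = ev H (q, p) by rewrite /ev /H /=; ring.
have symK p q : ev K (p, q) = ev K (q, p) by rewrite /ev /K /H /=; ring.
have evK : \sum_(q : quad | quadruples q && (q.1.2 < q.2.2)%N) ev H q
    = \sum_(q : quad | quadruples q && (q.1.1 < q.2.1)%N) ev K q.
  rewrite sum_quadruples_swap /= (eq_bigr (ev H)); last by case.
  rewrite (sum_quadruples_shear (fun a b x y => H a%:Z b%:Z x%:Z y%:Z)).
  apply: eq_bigr => -[[a x] [b y]] /andP[_ /= lt_ab].
  by rewrite /ev /K /= PoszD -subzn // ltnW.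
have eH := @sum_quadruples_trichotomy (fun p => p.2) _ symH.
have eK := @sum_quadruples_trichotomy (fun p => p.1) _ symK.
have dH : \sum_(q : quad | quadruples q && (q.1.2 == q.2.2)) ev H q
   = \sum_(p : I * I | factorizations p) n%:Z ^+ 2 * (p.1%:Z ^+ 2 - p.1%:Z).
  transitivity (\sum_(p : I * I | factorizations p) \sum_(1 <= a < p.1)
      H a%:Z (p.1 - a)%N%:Z p.2%:Z p.2%:Z).
    rewrite -(sum_quadruples_diag (fun a b x => H a%:Z b%:Z x%:Z x%:Z)).
    by apply: eq_bigr => -[[a x] [b y]] /andP[_ /eqP /= ->].
  apply: eq_bigr => -[d x] /and3P[/= d0 _ /eqP <-]; rewrite PoszM.
  transitivity (\sum_(1 <= a < d) (d%:Z * x%:Z) ^+ 2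
                  * (6 * a%:Z * (d%:Z - a%:Z) - d%:Z ^+ 2)).
    apply: eq_big_nat => a /andP[_ lt_ad]; rewrite -subzn ?(ltnW lt_ad) // /H; ring.
  (* with c = d and k = d - 1 this is d^2 - d *)
  have key (c : int) k : \sum_(1 <= a < k.+1) (6 * a%:Z * (c - a%:Z) - c ^+ 2)
      = 3 * c * k%:Z * (k%:Z + 1) - k%:Z * (k%:Z + 1) * (2 * k%:Z + 1) - k%:Z * c ^+ 2.
    elim: k => [|k IH]; first by rewrite big_nil; ring.
    by rewrite big_nat_recr //= IH -[k.+1]addn1 PoszD; ring.
  rewrite -mulr_sumr; congr (_ * _); move: d0; case: (nat_of_ord d) => // m _.
  by rewrite key -[m.+1]addn1 PoszD; ring.
have dK : \sum_(q : quad | quadruples q && (q.1.1 == q.2.1)) ev K q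
   = \sum_(p : I * I | factorizations p) n%:Z ^+ 2 * (p.1%:Z ^+ 2 - n%:Z * p.1%:Z).
  rewrite sum_quadruples_dual /=.
  transitivity (\sum_(p : I * I | factorizations p) \sum_(1 <= a < p.1)
      K p.2%:Z p.2%:Z a%:Z (p.1 - a)%N%:Z).
    rewrite -(sum_quadruples_diag (fun a b x => K x%:Z x%:Z a%:Z b%:Z)).
    by apply: eq_bigr => -[[a x] [b y]] /andP[_ /eqP /= ->].
  rewrite (reindex_inj (h := fun p : I * I => (p.2, p.1))); last first.
    by move=> [d x] [d' x'] [-> ->].
  apply: eq_big => -[d x]; rewrite /factorizations /=.
    by rewrite mulnC; apply/and3P/and3P => -[].
  case/and3P=> d0 x0 /eqP <-; rewrite PoszM.
  transitivity (\sum_(1 <= a < x) (- (d%:Z ^+ 4 * x%:Z ^+ 2))).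
    apply: eq_big_nat => a /andP[_ lt_ad].
    rewrite -subzn ?(ltnW lt_ad) // /K /H; ring.
  rewrite sumr_const_nat -mulr_natr natz -subzn //; ring.
transitivity (\sum_(q : quad | quadruples q) ev H q
              - \sum_(q : quad | quadruples q) ev K q).
  by rewrite -sumrB; apply: eq_bigr => q _; rewrite /ev /K /H; ring.
rewrite eH eK evK dH dK opprD addrACA subrr add0r -sumrB.
by apply: eq_bigr => p _; ring.
Qed.

End Quadruples.

(** * Chazy's equation and Niebur's formula *)

Section EisensteinSeries.
Variable M : nat.
Local Notation I := 'I_M.+1.
Local Notation pos p := ((0 < p.1)%N && (0 < p.2)%N).

Definition theta (p : {poly int}) : {poly int} := 'X * p^`().

Lemma thetaD p q : theta (p + q) = theta p + theta q.
Proof. by rewrite /theta derivD mulrDr. Qed.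

Lemma thetaN p : theta (- p) = - theta p.
Proof. by rewrite /theta derivN mulrN. Qed.

Lemma thetaM p q : theta (p * q) = theta p * q + p * theta q.
Proof. by rewrite /theta derivM; ring. Qed.

Lemma theta_nat n : theta n%:R = 0.
Proof. by rewrite /theta -polyC_natr derivC mulr0. Qed.

Lemma theta0 : theta 0 = 0.
Proof. exact: (theta_nat 0). Qed.

Lemma thetaXn n : theta 'X^n = n%:R * 'X^n.
Proof.
by case: n => [|n]; rewrite /theta derivXn ?mulr0n ?mulr0 ?mul0r // mulrnAr -exprS mulr_natl.
Qed.

Lemma coef_theta p i : (theta p)`_i = i%:R * p`_i.
Proof.
by case: i => [|i]; rewrite /theta coefXM ?mul0r //= coef_deriv mulr_natl.
Qed.

(** Up to degree M this is \sum n^k sigma(n) X^n, the k-th derivative under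
[theta] of the sum of the Lambert series a X^a / (1 - X^a).  The coefficients
beyond M have no meaning. *)
Definition lambert (k : nat) : {poly int} :=
  \sum_(p : I * I | pos p) (p.1%:Z * (p.1 * p.2)%N%:Z ^+ k) *: 'X^(p.1 * p.2).

Lemma theta_lambert k : theta (lambert k) = lambert k.+1.
Proof.
apply/polyP => i; rewrite coef_theta !coef_sum mulr_sumr.
apply: eq_bigr => p _; rewrite !coefZ coefXn; case: eqP => [->|_]; last by rewrite !mulr0.
by rewrite exprS natz; ring.
Qed.

Lemma coef_lambert k n :
  (lambert k)`_n = \sum_(p : I * I | factorizations n p) p.1%:Z * n%:Z ^+ k.
Proof.
rewrite coef_sum [RHS](eq_bigl (fun p : I * I => pos p && (p.1 * p.2 == n)%N)).
  rewrite [RHS]big_mkcondr; apply: eq_bigr => p _; rewrite coefZ coefXn eq_sym.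
  by case: eqP => [->|_]; rewrite ?mulr1 ?mulr0.
by move=> p; rewrite /factorizations andbA.
Qed.

Lemma coef_lambertM i j n :
  (lambert i * lambert j)`_n
  = \sum_(q : (I * I) * (I * I) | quadruples n q)
      q.1.1%:Z * q.2.1%:Z
      * ((q.1.1%:Z * q.1.2%:Z) ^+ i * (q.2.1%:Z * q.2.2%:Z) ^+ j).
Proof.
rewrite /lambert big_distrlr /= pair_big_dep /= coef_sum.
rewrite [RHS](eq_bigl (fun q : (I * I) * (I * I) =>
  (pos q.1 && pos q.2) && (q.1.1 * q.1.2 + q.2.1 * q.2.2 == n)%N)); last first.
  by move=> q; rewrite /quadruples -!andbA.
rewrite [RHS]big_mkcondr; apply: eq_bigr => q _.
rewrite -scalerAl -scalerAr scalerA -exprD coefZ coefXn eq_sym !PoszM.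
by case: eqP => _; rewrite ?mulr1 ?mulr0 //; ring.
Qed.

(** A multiple of X^(M+1) is kept as a witness, so that consequences of such
congruences reduce to ring identities. *)
Definition congX (p q : {poly int}) := exists r, p - q = r * 'X^(M.+1).

Lemma congXP (p q : {poly int}) : (forall i, (i <= M)%N -> p`_i = q`_i) -> congX p q.
Proof.
move=> epq; exists (drop_poly M.+1 (p - q)).
rewrite -[LHS](poly_take_drop M.+1) -[RHS]add0r; congr (_ + _).
apply/polyP => i; rewrite coef_take_poly coef0 coefB; case: ifP => // lt_iM.
by rewrite epq ?subrr.
Qed.

Lemma congX_coef (p q : {poly int}) i : congX p q -> (i <= M)%N -> p`_i = q`_i.
Proof.
move=> [r e] le_iM; apply/eqP; rewrite -subr_eq0 -coefB e coefMXn.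
by rewrite ltnS le_iM.
Qed.

Lemma congX_theta p : congX p 0 -> congX (theta p) 0.
Proof.
move=> cp; apply: congXP => i le_iM.
by rewrite coef_theta (congX_coef cp le_iM) coef0 mulr0.
Qed.

Local Notation s k := (lambert k).

Definition chazy : {poly int} := s 3 - s 2 + 24 * (s 0 * s 2) - 36 * (s 1 * s 1).

Lemma coefMnat k (p : {poly int}) i : (k%:R * p)`_i = k%:R * p`_i.
Proof. by rewrite !mulr_natl coefMn. Qed.

(** In degree n this is [van_der_Pol], after the product S D^2 S is replaced by the
half sum of S D^2 S and D^2 S S. *)
Lemma chazy_congX0 : congX chazy 0.
Proof.
apply: congXP => n le_nM; rewrite /chazy coef0 !(coefD, coefN).
rewrite !coefMnat.
rewrite -addrA (_ : (s 3)`_n - (s 2)`_n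
  = \sum_(p : I * I | factorizations n p) p.1%:Z * (n%:Z ^+ 3 - n%:Z ^+ 2)).
  rewrite -(van_der_Pol le_nM).
  have sym : (s 0 * s 2)`_n = (s 2 * s 0)`_n by rewrite mulrC.
  rewrite (_ : 24 * (s 0 * s 2)`_n = 12 * (s 0 * s 2)`_n + 12 * (s 2 * s 0)`_n).
    rewrite !coef_lambertM !mulr_sumr -!(sumrN, big_split) /=.
    by rewrite big1 // => q _; ring.
  by rewrite -sym; ring.
by rewrite !coef_lambert -sumrB; apply: eq_bigr => p _; ring.
Qed.

Definition niebur : {poly int} :=
  s 4 - 24 * (s 4 * s 0 - 16 * (s 3 * s 1) + 18 * (s 2 * s 2)).

(** D - (1 - 24 S) applied to [niebur] is a linear combination of Chazy's
expression C and its derivatives, namely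
(1 - 24 S) D^2 C + 360 DS DC - 480 D^2 S C. *)
Lemma theta_niebur : congX (theta niebur) ((1 - 24 * s 0) * niebur).
Proof.
have [r0 e0] := chazy_congX0.
have [r1 e1] := congX_theta chazy_congX0.
have [r2 e2] := congX_theta (congX_theta chazy_congX0).
exists ((1 - 24 * s 0) * r2 + 360 * s 1 * r1 - 480 * s 2 * r0).
transitivity ((1 - 24 * s 0) * (theta (theta chazy) - 0)
  + 360 * s 1 * (theta chazy - 0) - 480 * s 2 * (chazy - 0)); last first.
  by rewrite e0 e1 e2; ring.
rewrite !subr0 /chazy /niebur.
rewrite !(thetaD, thetaN, thetaM, theta_nat, theta_lambert, theta0).
by ring.
Qed.

Lemma coef_lambert0 k : (s k)`_0 = 0.
Proof.
rewrite coef_lambert big_pred0 // => p; rewrite /factorizations muln_eq0.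
by case: p => [[[|a] ?] [[|b] ?]].
Qed.

(** In degree i the equation determines (i - 1) p_i from the lower coefficients,
because S has no constant term. *)
Lemma theta_ode_unique (p q : {poly int}) :
  congX (theta p) ((1 - 24 * s 0) * p) ->
  congX (theta q) ((1 - 24 * s 0) * q) ->
  p`_0 = q`_0 -> p`_1 = q`_1 -> forall i, (i <= M)%N -> p`_i = q`_i.
Proof.
move=> cp cq e0 e1; elim/ltn_ind => -[|[|i]] // IH le_iM.
have key f : congX (theta f) ((1 - 24 * s 0) * f) ->
  i.+1%:R * f`_i.+2 = - 24 * \sum_(j < i.+2) (s 0)`_(lift ord0 j) * f`_(i.+2 - lift ord0 j).
  move=> /congX_coef /(_ le_iM); rewrite coef_theta mulrBl mul1r coefB -mulrA coefMnat.
  rewrite coefM big_ord_recl coef_lambert0 mul0r add0r -natr1 mulrDl mul1r.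
  by move=> e; rewrite mulNr; apply: (addIr f`_i.+2); rewrite e addrC.
apply: (@mulfI _ i.+1%:R); first by rewrite pnatr_eq0.
rewrite !key //; congr (_ * _); apply: eq_bigr => j _; congr (_ * _).
by apply: IH; rewrite lift0; lia.
Qed.


Lemma thetaXpow (p : {poly int}) n : theta (p ^+ n.+1) = n.+1%:R * p ^+ n * theta p.
Proof. by rewrite /theta deriv_exp -mulr_natl /=; ring. Qed.

Definition lambert_row (k : nat) : {poly int} :=
  \sum_(1 <= j < M.+1) k%:R * 'X^(k * j).

Lemma lambert0_rows : s 0 = \sum_(1 <= k < M.+1) lambert_row k.
Proof.
rewrite big_add1 /= big_mkord.
rewrite /lambert -(pair_big (fun a : I => (0 < a)%N) (fun x : I => (0 < x)%N)
  (fun a x : I => (a%:Z * (a * x)%N%:Z ^+ 0) *: 'X^(a * x))) /=.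
rewrite big_mkcond big_ord_recl /= add0r; apply: eq_bigr => a _.
rewrite /lambert_row big_add1 /= big_mkord big_mkcond big_ord_recl /= add0r.
apply: eq_bigr => x _; rewrite /bump /= !add1n expr0 mulr1.
by rewrite -mul_polyC -natz polyC_natr.
Qed.

(** The row is X^k / (1 - X^k) times k, up to a term of degree above M. *)
Lemma lambert_row_telescope k :
  (1 - 'X^k) * lambert_row k = k%:R * ('X^k - 'X^(k * M.+1)).
Proof.
rewrite /lambert_row; elim: M => [|m IH].
  by rewrite big_nil muln1 subrr !mulr0.
by rewrite big_nat_recr //= mulrDr IH (mulnS k m.+1) exprD; ring.
Qed.

Definition discriminant_product (m : nat) : {poly int} :=
  'X * \prod_(1 <= k < m.+1) (1 - 'X^k) ^+ 24.

(** Logarithmic differentiation: (1 - X^k)^24 has logarithmic derivative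
-24 k X^k / (1 - X^k), that is -24 times the k-th row of S. *)
Lemma theta_discriminant_product :
  congX (theta (discriminant_product M)) ((1 - 24 * s 0) * discriminant_product M).
Proof.
pose P m : {poly int} := \prod_(1 <= k < m.+1) (1 - 'X^k) ^+ 24.
pose R m : {poly int} := \sum_(1 <= k < m.+1) lambert_row k.
have key m : exists r, theta (P m) + 24 * R m * P m = r * 'X^(M.+1).
  elim: m => [|m [r IH]].
    exists 0; rewrite /P /R !big_nil (theta_nat 1); ring.
  have eP : P m.+1 = P m * (1 - 'X^(m.+1)) ^+ 24 by rewrite /P big_nat_recr.
  have eR : R m.+1 = R m + lambert_row m.+1 by rewrite /R big_nat_recr.
  have tele := lambert_row_telescope m.+1.
  exists (r * (1 - 'X^(m.+1)) ^+ 24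
     - 24 * m.+1%:R * P m * (1 - 'X^(m.+1)) ^+ 23 * 'X^(m * M.+1)).
  rewrite eP eR mulrBl -[r * _ * _]mulrAC -IH.
  have -> : 24 * m.+1%:R * P m * (1 - 'X^(m.+1)) ^+ 23 * 'X^(m * M.+1) * 'X^(M.+1)
    = 24 * P m * (1 - 'X^(m.+1)) ^+ 23 * (m.+1%:R * 'X^(m.+1)
        - (1 - 'X^(m.+1)) * lambert_row m.+1).
    by rewrite tele mulSn addnC exprD; ring.
  rewrite thetaM thetaXpow thetaD thetaN (theta_nat 1) thetaXn.
  have -> : (1 - 'X^(m.+1) : {poly int}) ^+ 24
     = (1 - 'X^(m.+1)) * (1 - 'X^(m.+1)) ^+ 23 by rewrite exprS.
  ring.
have [r e] := key M.
exists ('X * r); rewrite -mulrA -e lambert0_rows -/(R M) /discriminant_product -/(P M).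
rewrite thetaM -[X in theta X]expr1 thetaXn; ring.
Qed.

End EisensteinSeries.

(** The two solutions of the differential equation share their coefficients in
degrees 0 and 1, so tau l is the coefficient of degree l in [niebur l]. *)
Lemma tau_prime_mod24 l : prime l ->
  exists c : int, tau l = l%:Z ^+ 4 * (1 + l%:Z) - 24 * c.
Proof.
move=> pr_l; have l_gt1 := prime_gt1 pr_l.
have s0 k := coef_lambert0 l k.
have cM0 i j : (lambert l i * lambert l j)`_0 = 0.
  by rewrite coefM big_ord_recl big_ord0 s0 mul0r addr0.
have cM1 i j : (lambert l i * lambert l j)`_1 = 0.
  by rewrite coefM !big_ord_recl big_ord0 !s0 !mulr0 !mul0r !addr0.
have fact1 (p : 'I_l.+1 * 'I_l.+1) : factorizations 1 p = (p == (inord 1, inord 1)).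
  case: p => a x; rewrite /factorizations xpair_eqE -!val_eqE /= !inordK ?muln_eq1; try lia.
have s41 : (lambert l 4)`_1 = 1.
  rewrite coef_lambert (eq_bigl _ _ fact1) big_pred1_eq /= inordK //; lia.
have factl (p : 'I_l.+1 * 'I_l.+1) : factorizations l p =
    (p == (inord 1, inord l)) || (p == (inord l, inord 1)).
  case: p => a x; rewrite /factorizations !xpair_eqE -!val_eqE /= !inordK; try lia.
  apply/idP/idP => [/and3P[a0 x0 /eqP e]|]; last by lia.
  have dal : (a %| l)%N by apply/dvdnP; exists (x : nat); rewrite mulnC.
  by have /primeP[_ /(_ _ dal)/pred2P[a1|al]] := pr_l; apply/orP; [left|right]; nia.
have s4l : (lambert l 4)`_l = l%:Z ^+ 4 * (1 + l%:Z).
  rewrite coef_lambert (eq_bigl _ _ factl) (bigD1 (inord 1, inord l)) ?eqxx //=.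
  rewrite (big_pred1 (inord l, inord 1)) /=.
    by rewrite !inordK; try lia; ring.
  move=> p /=; case: (eqVneq p (inord 1, inord l)) => [->|_]; last by rewrite andbT.
  by rewrite andbF xpair_eqE -!val_eqE /= !inordK; lia.
exists (lambert l 4 * lambert l 0 - 16 * (lambert l 3 * lambert l 1)
  + 18 * (lambert l 2 * lambert l 2))`_l.
transitivity (niebur l)`_l; last first.
  by rewrite /niebur coefB coefMnat s4l.
have cG i : (niebur l)`_i = (lambert l 4)`_i - 24 *
   ((lambert l 4 * lambert l 0)`_i - 16 * (lambert l 3 * lambert l 1)`_i
     + 18 * (lambert l 2 * lambert l 2)`_i).
  by rewrite /niebur !(coefD, coefN, coefMnat).
apply: (@theta_ode_unique l (discriminant_product l)) (leqnn l).
- exact: theta_discriminant_product.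
- exact: theta_niebur.
- by rewrite cG !cM0 s0 coefXM; ring.
- rewrite cG !cM1 s41 coefXM /= -horner_coef0 horner_prod big1_seq //.
  move=> k /andP[_]; rewrite mem_index_iota => /andP[k0 _].
  by rewrite horner_exp !hornerE expr0n eqn0Ngt k0 subr0 expr1n.
Qed.

(** * Curves with a point of order 2 or 3 over a finite field *)

(** The cyclic group generated by f is a p-group without fixed points in A. *)
Lemma dvdn_card_iter_free (T : finType) (A : {set T}) (f : T -> T) (p : nat) :
  prime p -> (forall x, x \in A -> f x \in A) ->
  (forall x, x \in A -> iter p f x = x) -> (forall x, x \in A -> f x != x) ->
  (p %| #|A|)%N.
Proof.
move=> pr_p fA fp fx.
(* f need not be injective outside A *)
pose g x := if x \in A then f x else x.
have gA x : (g x \in A) = (x \in A).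
  by rewrite /g; case: ifP => // xA; rewrite fA.
have itg x n : x \in A -> iter n g x = iter n f x /\ iter n f x \in A.
  move=> xA; elim: n => [|n [IH1 IH2]] //=; split; last exact: fA.
  by rewrite IH1 /g IH2.
have itg' x n : x \notin A -> iter n g x = x.
  by move=> xA; elim: n => //= n ->; rewrite /g (negPf xA).
have gp x : iter p g x = x.
  by case: (boolP (x \in A)) => xA; [rewrite (itg x p xA).1 fp | rewrite itg'].
have g_inj : injective g.
  apply: (can_inj (g := iter p.-1 g)) => x.
  by rewrite -iterSr prednK ?prime_gt0.
pose s := perm g_inj.
have sp : (s ^+ p = 1)%g.
  by apply/permP => x; rewrite permX perm1 -[RHS]gp; apply: eq_iter => y; rewrite permE.
have pG : (p.-group <[s]>)%g.
  apply: (@pnat_dvd _ p); last by rewrite pnat_id.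
  by rewrite order_dvdn sp.
have actA : [acts <[s]>%g, on A | 'P].
  rewrite cycle_subG; apply/astabsP => x /=.
  by rewrite apermE permE gA.
rewrite /dvdn (pgroup_fix_mod pG actA) (_ : 'Fix_(A | 'P)(<[s]>)%g = set0) ?cards0 ?mod0n //.
apply/setP => x; rewrite in_setI in_set0; apply/andP => -[xA /afixP fix_x].
have := fix_x s (cycle_id s).
by rewrite /= apermE permE /g xA => /eqP; rewrite (negPf (fx x xA)).
Qed.

Section CurvesWithTorsion.
Variables (F : finFieldType) (W : weierstrass F).

Definition curve_points : {set point F} := [set P | on_curve W P].

(** Addition of the point (0, 0) on y^2 + a1 x y = x^3 + a2 x^2 + a4 x, where it
has order 2. *)
Definition translate2 (P : point F) : point F :=
  if P is Some (x, y) then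
    if x == 0 then None else Some (a4 W / x, - (a4 W * y / x ^+ 2) - a1 W * a4 W / x)
  else Some (0, 0).

(** A fixed point would have 2 y + a1 x = 0 and a4 = x^2, whence b2 = - 8 x; but
the discriminant is a4^2 (b2^2 - 64 a4). *)
Lemma dvd2_card : a3 W = 0 -> a6 W = 0 -> disc W != 0 -> (2 %| #|curve_points|)%N.
Proof.
move=> A3 A6 dW.
have A4 : a4 W != 0.
  by apply: contraNneq dW => A4; rewrite /disc /b8 /b6 /b4 /b2 A3 A4 A6; apply/eqP; ring.
apply: (@dvdn_card_iter_free _ _ translate2) => //.
- move=> [[x y]|]; rewrite !inE /= /on_affine ?A3 ?A6; last by move=> _; apply/eqP; ring.
  move=> /eqP e; have [//|x0] := eqVneq x 0; apply/eqP/subr0_eq; rewrite A3 A6.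
  transitivity (- a4 W ^+ 2 / x ^+ 4 * ((x ^+ 3 + a2 W * x ^+ 2 + a4 W * x + 0)
    - (y ^+ 2 + a1 W * x * y + 0 * y))); first by field.
  by rewrite e subrr mulr0.
- move=> [[x y]|]; rewrite !inE /= /on_affine ?A3 ?A6; last by rewrite eqxx.
  move=> /eqP e; have [x0|x0] := eqVneq x 0; rewrite /=.
    congr (Some (_, _)) => //; apply/esym/eqP; rewrite -sqrf_eq0; apply/eqP.
    by transitivity (y ^+ 2 + a1 W * x * y + 0 * y); [|rewrite e]; rewrite x0; ring.
  rewrite mulf_eq0 (negPf A4) invr_eq0 (negPf x0) /=.
  by congr (Some (_, _)); field; rewrite ?x0 ?A4.
- move=> [[x y]|]; rewrite !inE /= /on_affine ?A3 ?A6 //.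
  move=> /eqP e; have [//|x0] := eqVneq x 0; apply/eqP => -[ex ey].
  have e4 : a4 W = x ^+ 2 by rewrite expr2 -[X in X * _]ex divfK.
  have ey2 : 2 * y + a1 W * x = 0.
    by rewrite mulr2n mulrDl mul1r -[X in X + y + _]ey e4; field.
  have b2E : a1 W ^+ 2 + 4 * a2 W + 8 * x = 0.
    apply: (mulfI (expf_neq0 2 x0)); rewrite mulr0.
    transitivity ((2 * y + a1 W * x) ^+ 2 - 4 * ((y ^+ 2 + a1 W * x * y + 0 * y)
      - (x ^+ 3 + a2 W * x ^+ 2 + a4 W * x + 0))); first by rewrite e4; ring.
    by rewrite ey2 e subrr; ring.
  move/eqP: dW; apply.
  transitivity (x ^+ 4 * (a1 W ^+ 2 + 4 * a2 W - 8 * x)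
     * (a1 W ^+ 2 + 4 * a2 W + 8 * x)); last by rewrite b2E mulr0.
  by rewrite /disc /b8 /b6 /b4 /b2 A3 A6 e4; ring.
Qed.

(** Addition of the point (0, 0) on y^2 + a1 x y + a3 y = x^3, where it is a flex
and hence has order 3. *)
Definition translate3 (P : point F) : point F :=
  if P is Some (x, y) then
    if x == 0 then (if y == 0 then Some (0, - a3 W) else None)
    else Some (- (a3 W * y / x ^+ 2), - (a3 W ^+ 2 * y / x ^+ 3))
  else Some (0, 0).

(** A fixed point would have y = a3 and x^3 = - a3^2, whence a1 x = - 3 a3; but
the discriminant is a3^3 (a1^3 - 27 a3). *)
Lemma dvd3_card : a2 W = 0 -> a4 W = 0 -> a6 W = 0 -> disc W != 0 ->
  (3 %| #|curve_points|)%N.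
Proof.
move=> A2 A4 A6 dW.
have A3 : a3 W != 0.
  by apply: contraNneq dW => A3; rewrite /disc /b8 /b6 /b4 /b2 A2 A3 A4 A6; apply/eqP; ring.
have y0 x y : x != 0 ->
  y ^+ 2 + a1 W * x * y + a3 W * y = x ^+ 3 + 0 * x ^+ 2 + 0 * x + 0 -> y != 0.
  move=> x0 e; apply: contraNneq x0 => y0; suff: x ^+ 3 == 0 by rewrite expf_eq0.
  apply/eqP.
  by transitivity (x ^+ 3 + 0 * x ^+ 2 + 0 * x + 0); [|rewrite -e y0]; ring.
apply: (@dvdn_card_iter_free _ _ translate3) => //.
- move=> [[x y]|]; rewrite !inE /= /on_affine ?A2 ?A4 ?A6;
    last by move=> _; apply/eqP; ring.
  move=> /eqP e; have [_|x0] := eqVneq x 0.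
    by case: eqP => // _; apply/eqP; rewrite A2 A4 A6; ring.
  apply/eqP/subr0_eq; rewrite A2 A4 A6.
  transitivity (a3 W ^+ 3 * y / x ^+ 6 * ((y ^+ 2 + a1 W * x * y + a3 W * y)
    - (x ^+ 3 + 0 * x ^+ 2 + 0 * x + 0))); first by field.
  by rewrite e subrr mulr0.
- move=> [[x y]|]; rewrite !inE /= /on_affine ?A2 ?A4 ?A6; last first.
    by rewrite /= eqxx /= eqxx oppr_eq0 (negPf A3).
  move=> /eqP e; have [x0|x0] := eqVneq x 0; rewrite /=.
    have : y * (y + a3 W) = 0.
      by transitivity (y ^+ 2 + a1 W * x * y + a3 W * y); [|rewrite e]; rewrite x0; ring.
    have [->|y1] := eqVneq y 0; first by rewrite /= eqxx oppr_eq0 (negPf A3) x0.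
    move=> /eqP; rewrite mulf_eq0 (negPf y1) addr_eq0 => /eqP ->.
    by rewrite /= !eqxx x0.
  have y1 := y0 _ _ x0 e.
  rewrite oppr_eq0 !mulf_eq0 invr_eq0 expf_eq0 (negPf x0) (negPf A3) (negPf y1) /=.
  rewrite !(mulf_eq0, oppr_eq0, invr_eq0, expf_eq0) (negPf x0) (negPf A3) (negPf y1) /=.
  congr (Some (_, _)); field;
    by rewrite ?(oppr_eq0, mulf_eq0, expf_eq0) (negPf x0) (negPf A3) (negPf y1).
- move=> [[x y]|]; rewrite !inE /= /on_affine ?A2 ?A4 ?A6 //.
  move=> /eqP e; have [x0|x0] := eqVneq x 0.
    by case: (eqVneq y 0) => [->|//]; apply/eqP => -[_ /eqP]; rewrite oppr_eq0 (negPf A3).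
  have y1 := y0 _ _ x0 e.
  apply/eqP => -[ex ey].
  have x3 : x ^+ 3 = - a3 W ^+ 2.
    by apply: (mulfI y1); rewrite -[in LHS]ey; field.
  have ya : y = a3 W.
    have e3 : a3 W * y = - x ^+ 3.
      by rewrite [x ^+ 3]exprS -[X in - (X * _)]ex; field.
    by apply: (mulfI A3); rewrite e3 x3; ring.
  have a1E : 3 * a3 W + a1 W * x = 0.
    apply: (mulfI A3); rewrite mulr0.
    transitivity ((y ^+ 2 + a1 W * x * y + a3 W * y)
      - (x ^+ 3 + 0 * x ^+ 2 + 0 * x + 0)); first by rewrite x3 ya; ring.
    by rewrite e subrr.
  move/eqP: dW; apply.
  transitivity (- a3 W * ((3 * a3 W + a1 W * x)
      * ((3 * a3 W) ^+ 2 - 3 * a3 W * (a1 W * x) + (a1 W * x) ^+ 2)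
    - a1 W ^+ 3 * (x ^+ 3 + a3 W ^+ 2))); last by rewrite a1E x3; ring.
  by rewrite /disc /b8 /b6 /b4 /b2 A2 A4 A6; ring.
Qed.

End CurvesWithTorsion.

(** * Changes of variables and normal forms *)

Section Translation.

(** The change of variables x = x' + r, y = y' + s x' + t. *)
Definition translate (R : comNzRingType) (W : weierstrass R) (r s t : R) :=
  Weierstrass (a1 W + 2 * s) (a2 W - s * a1 W + 3 * r - s ^+ 2)
    (a3 W + r * a1 W + 2 * t)
    (a4 W - s * a3 W + 2 * r * a2 W - (t + r * s) * a1 W + 3 * r ^+ 2 - 2 * s * t)
    (a6 W + r * a4 W + r ^+ 2 * a2 W + r ^+ 3 - t * a3 W - t ^+ 2 - r * t * a1 W).

Lemma disc_translate (R : comNzRingType) (W : weierstrass R) r s t :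
  disc (translate W r s t) = disc W.
Proof. by rewrite /disc /b8 /b6 /b4 /b2 /=; ring. Qed.

Lemma card_translate (F : finFieldType) (W : weierstrass F) r s t :
  #|curve_points (translate W r s t)| = #|curve_points W|.
Proof.
pose f : point F -> point F := omap (fun xy => (xy.1 + r, xy.2 + s * xy.1 + t)).
pose g : point F -> point F := omap (fun xy => (xy.1 - r, xy.2 - s * (xy.1 - r) - t)).
have fK : cancel f g by move=> [[x y]|] //; rewrite /f /g /=; congr (Some (_, _)); ring.
have gK : cancel g f by move=> [[x y]|] //; rewrite /f /g /=; congr (Some (_, _)); ring.
rewrite -[RHS](on_card_preimset (f := f)); last by exists g => x _.
apply: eq_card => -[[x y]|]; rewrite !inE /f //= /on_affine /=.
rewrite -subr_eq0 -[RHS]subr_eq0; congr (_ == 0); ring.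
Qed.

(** The point (r, t) lies on the curve and its tangent is vertical, so that it has
order 2: it becomes the origin of the translated curve, whose a3 and a6 are the
same for every slope of the translation. *)
Definition normal2 (R : comNzRingType) (W : weierstrass R) (r t : R) : Prop :=
  a3 (translate W r 0 t) = 0 /\ a6 (translate W r 0 t) = 0.

(** The line of slope s through (r, t) meets the curve there with multiplicity 3,
so that (r, t) is a flex. *)
Definition normal3 (R : comNzRingType) (W : weierstrass R) (r s t : R) : Prop :=
  [/\ a2 (translate W r s t) = 0, a4 (translate W r s t) = 0
    & a6 (translate W r s t) = 0].

Lemma normal2_of_order2 (F : fieldType) (W : weierstrass F) (P : point F) :
  on_curve W P -> has_exact_order W P 2 -> exists r t, normal2 W r t.
Proof.
move=> onP [_ mul2P ordP]; have := ordP 1%N isT; move: onP mul2P {ordP}.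
case: P => [[x y]|] //= /eqP onP; rewrite eqxx /=; case: eqP => // ye _ _.
exists x, y; rewrite /normal2 /=; split; first by rewrite -ye; ring.
apply/eqP; rewrite -subr_eq0 -(subrr (y ^+ 2 + a1 W * x * y + a3 W * y)) {1}onP.
by apply/eqP; ring.
Qed.

(** 3 P = 0 says that 2 P and P have the same abscissa; with m the slope of the
tangent at P, this is the vanishing of a2 after translation by (x, m, y), while
a4 vanishes by the choice of m and a6 because P lies on the curve. *)
Lemma normal3_of_order3 (F : fieldType) (W : weierstrass F) (P : point F) :
  on_curve W P -> has_exact_order W P 3 -> exists r s t, normal3 W r s t.
Proof.
move=> onP [_ mul3P ordP]; have := ordP 1%N isT; move: onP mul3P {ordP}.
case: P => [[x y]|] //= /eqP onP; rewrite eqxx /=; case: eqP => // /eqP ye.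
set m := (_ / _); case: eqP => [x3|//]; case: eqP => // y3 _ _.
have mE : m * (2 * y + a1 W * x + a3 W) = 3 * x ^+ 2 + 2 * a2 W * x + a4 W - a1 W * y.
  rewrite /m divfK //; apply: contraNneq ye => <-; apply/eqP; ring.
exists x, m, y; rewrite /normal3 /=; split.
- by apply/eqP; rewrite -(subrr x) [X in _ == _ - X]x3; apply/eqP; ring.
- transitivity (3 * x ^+ 2 + 2 * a2 W * x + a4 W - a1 W * y
    - m * (2 * y + a1 W * x + a3 W)); first by ring.
  by rewrite mE subrr.
- transitivity (x ^+ 3 + a2 W * x ^+ 2 + a4 W * x + a6 W
     - (y ^+ 2 + a1 W * x * y + a3 W * y)); first by ring.
  by rewrite onP subrr.
Qed.

(** A change of variables is a translation followed by a scaling by u. *)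
Lemma change_of_variablesE (F : fieldType) (W W' : weierstrass F) u r s t :
  u != 0 -> change_of_variables W u r s t W' ->
  [/\ a1 W' = a1 (translate W r s t) / u, a2 W' = a2 (translate W r s t) / u ^+ 2,
      a3 W' = a3 (translate W r s t) / u ^+ 3, a4 W' = a4 (translate W r s t) / u ^+ 4
    & a6 W' = a6 (translate W r s t) / u ^+ 6].
Proof. by move=> u0 [e1 e2 e3 e4 e6]; split; rewrite /= -?e1 -?e2 -?e3 -?e4 -?e6; field. Qed.

Lemma disc_change_of_variables (F : fieldType) (W W' : weierstrass F) u r s t :
  u != 0 -> change_of_variables W u r s t W' -> disc W' = disc W / u ^+ 12.
Proof.
move=> u0 /(change_of_variablesE u0) [e1 e2 e3 e4 e6].
rewrite -(disc_translate W r s t); move: (translate _ _ _ _) e1 e2 e3 e4 e6 => V.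
by rewrite /disc /b8 /b6 /b4 /b2 => -> -> -> -> ->; field.
Qed.

Lemma normal2_change_of_variables (F : fieldType) (W W' : weierstrass F) u r s t r0 t0 :
  u != 0 -> change_of_variables W u r s t W' -> normal2 W r0 t0 ->
  exists r' t', normal2 W' r' t'.
Proof.
move=> u0 /(change_of_variablesE u0) [e1 e2 e3 e4 e6] [n3 n6].
exists ((r0 - r) / u ^+ 2), ((t0 - t - s * (r0 - r)) / u ^+ 3).
rewrite /normal2 /= e1 e2 e3 e4 e6 /=; split.
  by apply: etrans (_ : a3 (translate W r0 0 t0) / u ^+ 3 = 0);
    [rewrite /=; field|rewrite n3 mul0r].
by apply: etrans (_ : a6 (translate W r0 0 t0) / u ^+ 6 = 0);
    [rewrite /=; field|rewrite n6 mul0r].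
Qed.

Lemma normal3_change_of_variables (F : fieldType) (W W' : weierstrass F) u r s t r0 s0 t0 :
  u != 0 -> change_of_variables W u r s t W' -> normal3 W r0 s0 t0 ->
  exists r' s' t', normal3 W' r' s' t'.
Proof.
move=> u0 /(change_of_variablesE u0) [e1 e2 e3 e4 e6] [n2 n4 n6].
exists ((r0 - r) / u ^+ 2), ((s0 - s) / u), ((t0 - t - s * (r0 - r)) / u ^+ 3).
rewrite /normal3 /= e1 e2 e3 e4 e6 /=; split.
- by apply: etrans (_ : a2 (translate W r0 s0 t0) / u ^+ 2 = 0);
    [rewrite /=; field|rewrite n2 mul0r].
- by apply: etrans (_ : a4 (translate W r0 s0 t0) / u ^+ 4 = 0);
    [rewrite /=; field|rewrite n4 mul0r].
- by apply: etrans (_ : a6 (translate W r0 s0 t0) / u ^+ 6 = 0);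
    [rewrite /=; field|rewrite n6 mul0r].
Qed.

End Translation.

(** * Reduction of rational parameters *)

Section ReductionOfRationals.
Variable F : fieldType.

(** The residue map from the rationals with denominator prime to the
characteristic, as a relation: no choice of a fraction is made, which makes it
visibly compatible with the ring operations. *)
Definition reduces (r : rat) (z : F) : Prop := exists n d : int,
  [/\ d%:~R != 0 :> F, r = n%:~R / d%:~R & z = n%:~R / d%:~R].

Lemma intr_neq0_rat (d : int) : d%:~R != 0 :> F -> d%:~R != 0 :> rat.
Proof. by apply: contraNneq => /eqP; rewrite intr_eq0 => /eqP ->. Qed.

Lemma reduces_int (n : int) : reduces n%:~R n%:~R.
Proof. by exists n, 1; rewrite !divr1 oner_neq0. Qed.

Lemma reduces_nat (n : nat) : reduces n%:R n%:R.
Proof. exact: (reduces_int n). Qed.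

Lemma reducesD r1 r2 z1 z2 :
  reduces r1 z1 -> reduces r2 z2 -> reduces (r1 + r2) (z1 + z2).
Proof.
move=> [n1 [d1 [h1 -> ->]]] [n2 [d2 [h2 -> ->]]].
exists (n1 * d2 + n2 * d1), (d1 * d2).
have := intr_neq0_rat h1; have := intr_neq0_rat h2.
by rewrite !(rmorphD, rmorphM) /= mulf_neq0 // => ? ?; split => //; field; apply/andP.
Qed.

Lemma reducesM r1 r2 z1 z2 :
  reduces r1 z1 -> reduces r2 z2 -> reduces (r1 * r2) (z1 * z2).
Proof.
move=> [n1 [d1 [h1 -> ->]]] [n2 [d2 [h2 -> ->]]].
exists (n1 * n2), (d1 * d2).
have := intr_neq0_rat h1; have := intr_neq0_rat h2.
by rewrite !rmorphM /= mulf_neq0 // => ? ?; split => //; field; apply/andP.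
Qed.

Lemma reducesN r z : reduces r z -> reduces (- r) (- z).
Proof.
by move=> [n [d [d0 -> ->]]]; exists (- n), d; rewrite !rmorphN !mulNr.
Qed.

Lemma reducesX r z k : reduces r z -> reduces (r ^+ k) (z ^+ k).
Proof.
move=> rz; elim: k => [|k IH]; first exact: (reduces_nat 1).
by rewrite !exprS; apply: reducesM.
Qed.

Lemma reduces_divz r z (k : int) :
  k%:~R != 0 :> F -> reduces r z -> reduces (r / k%:~R) (z / k%:~R).
Proof.
by move=> k0 rz; apply: reducesM rz _; exists 1, k; rewrite !mul1r.
Qed.

Lemma reduces0 z : reduces 0 z -> z = 0.
Proof.
move=> [n [d [d0 /eqP e ->]]]; move: e.
rewrite eq_sym mulf_eq0 invr_eq0 (negPf (intr_neq0_rat d0)) orbF intr_eq0.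
by move=> /eqP ->; rewrite mul0r.
Qed.

(** The rational root theorem: the denominator is prime to the numerator, so it
divides the leading coefficient k. *)
Lemma reduces_num_den r (k q : int) (m : nat) :
  k%:~R != 0 :> F -> k * numq r ^+ m = denq r * q -> exists z, reduces r z.
Proof.
move=> k0 e; exists ((numq r)%:~R / (denq r)%:~R), (numq r), (denq r).
split => //; last by rewrite divq_num_den.
have cop : coprimez (denq r) (numq r ^+ m).
  by rewrite coprimezXr // coprimez_sym; exact: coprime_num_den.
have /dvdzP[c kE] : (denq r %| k)%Z.
  by rewrite -(Gauss_dvdzl _ cop) e dvdz_mulr.
by apply: contraNneq k0 => d0; rewrite kE rmorphM /= d0 mulr0.
Qed.

Lemma reduces_quadratic r b c zb zc :
  reduces b zb -> reduces c zc -> r ^+ 2 + b * r + c = 0 -> exists z, reduces r z.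
Proof.
move=> [n1 [d1 [h1 -> _]]] [n2 [d2 [h2 -> _]]] e.
pose n := numq r; pose d := denq r.
apply: (@reduces_num_den r (d1 * d2) (- (n1 * d2 * n + n2 * d1 * d)) 2).
  by rewrite rmorphM mulf_neq0.
apply: (@intr_inj rat); apply/subr0_eq.
have h1' := intr_neq0_rat h1; have h2' := intr_neq0_rat h2.
have d0 : d%:~R != 0 :> rat by rewrite intr_eq0 denq_neq0.
transitivity (d1%:~R * d2%:~R * d%:~R ^+ 2 * (r ^+ 2 + n1%:~R / d1%:~R * r + n2%:~R / d2%:~R));
  last by rewrite e mulr0.
rewrite -[in RHS](divq_num_den r) -/n -/d !(rmorph_nat, rmorphXn, rmorphM, rmorphN, rmorphD) /=.
by field; rewrite h1' h2' d0.
Qed.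

Local Notation QW := (map_weierstrass (fun z : int => z%:~R : rat)).
Local Notation FW := (map_weierstrass (fun z : int => z%:~R : F)).

Ltac reduces_auto := repeat first
  [ assumption | exact: reduces_int | exact: reduces_nat | apply: reducesD
  | apply: reducesN | apply: reducesM | apply: reducesX ].

(** b6 of the translated curve is the value at n / d of the 2-division polynomial,
which has leading coefficient 4. *)
Lemma b6_translate_fraction (K : fieldType) (V : weierstrass K) (n d s t : K) :
  d != 0 ->
  4 * n ^+ 3 + d * (b2 V * n ^+ 2 + 2 * b4 V * n * d + b6 V * d ^+ 2)
  = d ^+ 3 * b6 (translate V (n / d) s t).
Proof. by move=> d0; rewrite /b6 /b4 /b2 /=; field. Qed.

(** b8 of the translated curve is the value at n / d of the 3-division polynomial,
which has leading coefficient 3. *)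
Lemma b8_translate_fraction (K : fieldType) (V : weierstrass K) (n d s t : K) :
  d != 0 ->
  3 * n ^+ 4 + d * (b2 V * n ^+ 3 + 3 * b4 V * n ^+ 2 * d
                    + 3 * b6 V * n * d ^+ 2 + b8 V * d ^+ 3)
  = d ^+ 4 * b8 (translate V (n / d) s t).
Proof. by move=> d0; rewrite /b8 /b6 /b4 /b2 /=; field. Qed.

Lemma b2_map (K : comNzRingType) (W : weierstrass int) :
  b2 (map_weierstrass (fun z : int => z%:~R : K) W) = (b2 W)%:~R.
Proof. by rewrite /b2 !(rmorphD, rmorphXn, rmorphM, rmorph_nat). Qed.

Lemma b4_map (K : comNzRingType) (W : weierstrass int) :
  b4 (map_weierstrass (fun z : int => z%:~R : K) W) = (b4 W)%:~R.
Proof. by rewrite /b4 !(rmorphD, rmorphXn, rmorphM, rmorph_nat). Qed.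

Lemma b6_map (K : comNzRingType) (W : weierstrass int) :
  b6 (map_weierstrass (fun z : int => z%:~R : K) W) = (b6 W)%:~R.
Proof. by rewrite /b6 !(rmorphD, rmorphXn, rmorphM, rmorph_nat). Qed.

Lemma b8_map (K : comNzRingType) (W : weierstrass int) :
  b8 (map_weierstrass (fun z : int => z%:~R : K) W) = (b8 W)%:~R.
Proof. by rewrite /b8 !(rmorphD, rmorphN, rmorphXn, rmorphM, rmorph_nat). Qed.

Lemma disc_map (K : comNzRingType) (W : weierstrass int) :
  disc (map_weierstrass (fun z : int => z%:~R : K) W) = (disc W)%:~R.
Proof.
rewrite /disc b2_map b4_map b6_map b8_map.
move: (b2 W) (b4 W) (b6 W) (b8 W) => c2 c4 c6 c8.
by rewrite !(rmorphD, rmorphN, rmorphXn, rmorphM, rmorph_nat).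
Qed.

(** b6 vanishes on the normal form, so r is a root of the 2-division polynomial,
and t is then obtained by a division by 2. *)
Lemma normal2_reduces (W : weierstrass int) r t :
  (2 : F) != 0 -> normal2 (QW W) r t -> exists r' t', normal2 (FW W) r' t'.
Proof.
move=> two [e3 e6].
have [zr hr] : exists z, reduces r z.
  pose n := numq r; pose d := denq r.
  apply: (@reduces_num_den r 4 (- (b2 W * n ^+ 2 + 2 * b4 W * n * d + b6 W * d ^+ 2)) 3).
    by rewrite (_ : 4%:~R = 2 * 2 :> F) ?mulf_neq0 // -natrM.
  have d0 : d%:~R != 0 :> rat by rewrite intr_eq0 denq_neq0.
  apply: (@intr_inj rat); apply/subr0_eq; rewrite -rmorphB /= mulrN opprK.
  move: (b2 W) (b4 W) (b6 W) (b2_map rat W) (b4_map rat W) (b6_map rat W).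
  move=> c2 c4 c6 h2 h4 h6.
  rewrite !(rmorph_nat, rmorphXn, rmorphM, rmorphD) /= -h2 -h4 -h6.
  by rewrite (b6_translate_fraction _ _ 0 t d0) divq_num_den /b6 e3 e6; ring.
case: W e3 e6 => [A1 A2 A3 A4 A6] /= e3 e6.
have [zt ht] : exists z, reduces t z.
  exists (- (A3%:~R + zr * A1%:~R) / 2%:~R).
  have -> : t = - (A3%:~R + r * A1%:~R) / 2%:~R.
    have e : 2 * t = - (A3%:~R + r * A1%:~R).
      by apply/eqP; rewrite -addr_eq0 addrC e3.
    by rewrite -e mulrC mulKf.
  by apply: reduces_divz => //; reduces_auto.
exists zr, zt; split; apply: reduces0 => /=.
  by rewrite -e3; reduces_auto.
by rewrite -e6; reduces_auto.
Qed.

(** b8 vanishes on the normal form, so r is a root of the 3-division polynomial;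
then s and t are roots of the monic quadratic equations a2 = 0 and a6 = 0. *)
Lemma normal3_reduces (W : weierstrass int) r s t :
  (3 : F) != 0 -> normal3 (QW W) r s t -> exists r' s' t', normal3 (FW W) r' s' t'.
Proof.
move=> three [e2 e4 e6].
have [zr hr] : exists z, reduces r z.
  pose n := numq r; pose d := denq r.
  apply: (@reduces_num_den r 3 (- (b2 W * n ^+ 3 + 3 * b4 W * n ^+ 2 * d
     + 3 * b6 W * n * d ^+ 2 + b8 W * d ^+ 3)) 4); first exact: three.
  have d0 : d%:~R != 0 :> rat by rewrite intr_eq0 denq_neq0.
  apply: (@intr_inj rat); apply/subr0_eq; rewrite -rmorphB /= mulrN opprK.
  move: (b2 W) (b4 W) (b6 W) (b8 W) (b2_map rat W) (b4_map rat W) (b6_map rat W) (b8_map rat W).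
  move=> c2 c4 c6 c8 h2 h4 h6 h8.
  rewrite !(rmorph_nat, rmorphXn, rmorphM, rmorphD) /= -h2 -h4 -h6 -h8.
  by rewrite (b8_translate_fraction _ _ s t d0) divq_num_den /b8 e2 e4 e6; ring.
case: W e2 e4 e6 => [A1 A2 A3 A4 A6] /= e2 e4 e6.
have [zs hs] : exists z, reduces s z.
  apply: (@reduces_quadratic s A1%:~R (- (A2%:~R + 3 * r)) A1%:~R (- (A2%:~R + 3 * zr)));
    try by reduces_auto.
  by apply/eqP; rewrite -oppr_eq0 -e2; apply/eqP; ring.
have [zt ht] : exists z, reduces t z.
  apply: (@reduces_quadratic t (A3%:~R + r * A1%:~R)
     (- (A6%:~R + r * A4%:~R + r ^+ 2 * A2%:~R + r ^+ 3)) (A3%:~R + zr * A1%:~R)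
     (- (A6%:~R + zr * A4%:~R + zr ^+ 2 * A2%:~R + zr ^+ 3))); try by reduces_auto.
  by apply/eqP; rewrite -oppr_eq0 -e6; apply/eqP; ring.
exists zr, zs, zt; split; apply: reduces0 => /=.
- by rewrite -e2; reduces_auto.
- by rewrite -e4; reduces_auto.
- by rewrite -e6; reduces_auto.
Qed.

End ReductionOfRationals.

(** * Good reduction outside the conductor *)

Section GoodReduction.
Variable E : elliptic_curve rat.

(** If a is a common denominator of the coefficients, scaling by u = 1 / a clears
all denominators. *)
Lemma integral_model_exists : exists W, is_integral_model E W.
Proof.
have [q [a a0 /polyP e]] :=
  rat_poly_scale (Poly [:: a1 E; a2 E; a3 E; a4 E; a6 E]).
have {}e i : [:: a1 E; a2 E; a3 E; a4 E; a6 E]`_i = a%:~R^-1 * (q`_i)%:~R.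
  by have := e i; rewrite coef_Poly coefZ coef_map.
exists (Weierstrass q`_0 (a * q`_1) (a ^+ 2 * q`_2) (a ^+ 3 * q`_3) (a ^+ 5 * q`_4)).
exists a%:~R^-1, 0, 0, 0; rewrite invr_eq0 intr_eq0; split=> //.
have a0' : a%:~R != 0 :> rat by rewrite intr_eq0.
have e0 := e 0%N; have e1 := e 1%N; have e2 := e 2%N; have e3 := e 3%N; have e4 := e 4%N.
rewrite /= in e0 e1 e2 e3 e4.
by split; rewrite /= ?rmorphM ?rmorphXn /= ?(e0, e1, e2, e3, e4);
  rewrite !(mulr0, mul0r, expr0n, addr0, subr0) /=; field.
Qed.

Lemma disc_integral_model_neq0 W : is_integral_model E W -> disc W != 0.
Proof.
move=> [u [r [s [t [u0 /(disc_change_of_variables u0) e]]]]].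
apply: contraTneq (ec_disc_neq0 E) => dW.
move: e; rewrite disc_map dW => /eqP; rewrite eq_sym mulf_eq0 invr_eq0 expf_eq0 (negPf u0).
by rewrite orbF negbK.
Qed.

Lemma minimal_model_spec l : is_minimal_model E l (minimal_model E l).
Proof.
apply: epsilon_spec; have [W0 hW0] := integral_model_exists.
pose P n := `[< exists W, is_integral_model E W /\ logn l `|disc W| = n >].
have exP : exists n, P n by exists (logn l `|disc W0|); apply/asboolP; exists W0.
case: (ex_minnP exP) => n /asboolP [W [hW eW]] minW.
exists W; split=> // W' hW'; rewrite eW; apply: minW.
by apply/asboolP; exists W'.
Qed.

(** At a bad prime l divides the discriminant of the minimal model, hence by
minimality that of the chosen integral model, and the conductor exponent at l is
positive whatever the wild part is. *)
Lemma conductor_good_reduction l :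
  prime l -> ~~ (l %| conductor E)%N -> good_reduction E l.
Proof.
move=> pr_l; apply: contraR => bad.
have [hW minW] := minimal_model_spec l.
have dW := disc_integral_model_neq0 hW.
have hI : is_integral_model E (integral_model E).
  exact: epsilon_spec integral_model_exists.
have dI := disc_integral_model_neq0 hI.
have l_dW : (l %| `|disc (minimal_model E l)|)%N.
  move: bad; rewrite /good_reduction negbK disc_map.
  by rewrite -(dvdz_pcharf (pchar_Fp pr_l)).
have l_bad : l \in primes `|disc (integral_model E)|.
  rewrite -logn_gt0; apply: leq_trans (minW _ hI).
  by rewrite logn_gt0 mem_primes pr_l l_dW absz_gt0 dW.
rewrite /conductor (bigD1_seq l) ?primes_uniq //=.
apply/dvdn_mulr/dvdn_exp => //; rewrite /conductor_exponent (negPf bad).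
by case: ifP.
Qed.

End GoodReduction.

(** The rational normal form is carried from E to the minimal model, then modulo
l, where translation by the point of order p acts freely. *)
Lemma dvd_card_reduction (p l : nat) (E : elliptic_curve rat) (P : point rat) :
  p = 2%N \/ p = 3%N -> on_curve E P -> has_exact_order E P p ->
  prime l -> ~~ (l %| p)%N -> good_reduction E l -> (p %| card_reduction E l)%N.
Proof.
move=> hp onP ordP pr_l l_p good.
have [[u [r [s [t [u0 cov]]]]] _] := minimal_model_spec E l.
have p0 : p%:R != 0 :> 'F_l by rewrite -(dvdn_pcharf (pchar_Fp pr_l)).
case: hp => ep; rewrite ep in ordP l_p p0 *.
- have [r0 [t0]] := normal2_of_order2 onP ordP.
  move=> /(normal2_change_of_variables u0 cov) [r1 [t1]].
  move=> /(normal2_reduces p0) [r2 [t2 [n3 n6]]].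
  rewrite /card_reduction -/(curve_points _) -(card_translate _ r2 0 t2).
  by apply: dvd2_card; rewrite ?disc_translate.
- have [r0 [s0 [t0]]] := normal3_of_order3 onP ordP.
  move=> /(normal3_change_of_variables u0 cov) [r1 [s1 [t1]]].
  move=> /(normal3_reduces p0) [r2 [s2 [t2 [n2 n4 n6]]]].
  rewrite /card_reduction -/(curve_points _) -(card_translate _ r2 s2 t2).
  by apply: dvd3_card; rewrite ?disc_translate.
Qed.

(** * The congruence *)

Theorem theoremA (p : nat) (hp : p = 2%N \/ p = 3%N)
  (E : elliptic_curve rat)
  (hE : exists P : point rat, on_curve E P /\ has_exact_order E P p)
  (l : nat) (hl : prime l) (hlN : ~~ (l %| p * conductor E)%N) :
  (trace_frob E l = tau l %[mod p%:Z])%Z.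
Proof.
have [P [onP ordP]] := hE.
move: hlN; rewrite Euclid_dvdM // negb_or => /andP[l_p /(conductor_good_reduction hl) good].
have := dvd_card_reduction hp onP ordP hl l_p good.
have [c ->] := tau_prime_mod24 hl; rewrite /trace_frob => /dvdnP[k ->].
apply/eqP; rewrite eqz_mod_dvd.
have p_l : ~~ (p %| l)%N.
  by apply: contra l_p; rewrite dvdn_prime2 // => [/eqP -> //|]; case: hp => ->.
(* p divides 1 - l^2 because it is prime to l and at most 3 *)
have [j [i [p24 ls]]] : exists j i : int,
    24 = p%:Z * j /\ (1 + l%:Z) * (1 - l%:Z) = p%:Z * i.
  move: p_l; rewrite (divn_eq l p) /dvdn modnMDl modn_mod PoszD PoszM.
  move: (l %/ p)%N => m; case: hp => ->.
    case: (l %% 2)%N (ltn_pmod l (isT : (0 < 2)%N)) => [|[|]] // _ _.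
    by exists 12, (- 2 * m%:Z * (m%:Z + 1)); split=> //; ring.
  case: (l %% 3)%N (ltn_pmod l (isT : (0 < 3)%N)) => [|[|[|]]] // _ _.
    by exists 8, (- m%:Z * (3 * m%:Z + 2)); split=> //; ring.
  by exists 8, (- (m%:Z + 1) * (3 * m%:Z + 1)); split=> //; ring.
apply/dvdzP; exists (i * (1 + l%:Z) * (1 + l%:Z ^+ 2) - k%:Z + j * c).
transitivity ((1 + l%:Z) * (1 - l%:Z) * (1 + l%:Z) * (1 + l%:Z ^+ 2)
   - k%:Z * p%:Z + 24 * c); first by rewrite PoszM; ring.
by rewrite p24 ls; ring.
Qed.
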